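(* Let $n \geq 1$. The C*-algebra $C^\ast(Q_n)$ is $2^{n-1}$-subhomogeneous, i.e. every irreducible representation of $C^\ast(Q_n)$ acts on a Hilbert space of dimension at most $2^{n-1}$. Moreover, for every irreducible representation $\rho$ of $C^\ast(Q_n)$ on a Hilbert space $\mathcal{H}$ and every vertex $x \in U_n \cup V_n$ one has $\dim(\rho(p_x)\mathcal{H}) \leq 1$.
   Context: For $n \geq 1$, identify each integer $0 \le i < 2^n$ with its $n$-digit binary representation $i_{n-1}\dots i_1 i_0$ (so $i = \sum_{k=0}^{n-1} i_k 2^k$, $i_k \in \{0,1\}$) and write $\mathrm{par}_k(i) = \sum_{\ell=0}^{k} i_\ell \bmod 2$. For $k<n$, $i \# k$ denotes the integer obtained from $i$ by flipping its $k$-th binary digit. The hypercube $Q_n$ is the bipartite graph with vertex sets $U_n = \{i < 2^n \mid \mathrm{par}_{n-1}(i) = 0\}$, $V_n = \{j < 2^n \mid \mathrm{par}_{n-1}(j)=1\}$, in which $i \in U_n$ and $j \in V_n$ are adjacent iff $j = i \# k$ for some $k<n$. The hypercube C*-algebra $C^\ast(Q_n)$ is the universal unital C*-algebra generated by projections $p_x$, $x \in U_n \cup V_n$, subject to $\sum_{u \in U_n} p_u = 1 = \sum_{v \in V_n} p_v$ and $p_u p_v = 0$ whenever $u \in U_n$, $v \in V_n$ are not adjacent in $Q_n$. *)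

(* Defs.v *)
From HB Require Import structures.
From mathcomp Require Import all_boot all_order all_algebra reals complex.
Set Implicit Arguments. Unset Strict Implicit. Unset Printing Implicit Defensive.
Import Order.TTheory GRing.Theory Num.Theory.
Local Open Scope ring_scope.

Definition bit (i k : nat) : bool := odd (i %/ 2 ^ k)%N.

Definition par (n i : nat) : bool := odd (\sum_(k < n) bit i k)%N.

Definition flip (i k : nat) : nat := (if bit i k then i - 2 ^ k else i + 2 ^ k)%N.

Definition inU (n : nat) (i : 'I_(2 ^ n)) : bool := ~~ par n i.
Definition inV (n : nat) (j : 'I_(2 ^ n)) : bool := par n j.

Definition adjacent (n : nat) (i j : 'I_(2 ^ n)) : Prop :=
  exists k : 'I_n, nat_of_ord j = flip i k.

Section Hilbert.
Variables (R : realType) (H : lmodType R[i]).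
Variable ip : H -> H -> R[i].

Definition nrm2 (u : H) : R := complex.Re (ip u u).

Definition cauchy_seq (s : nat -> H) : Prop :=
  forall e : R, 0 < e -> exists N : nat, forall m k : nat,
    (N <= m)%N -> (N <= k)%N -> nrm2 (s m - s k) < e.

Definition converges_to (s : nat -> H) (x : H) : Prop :=
  forall e : R, 0 < e -> exists N : nat, forall m : nat,
    (N <= m)%N -> nrm2 (s m - x) < e.

Definition is_hilbert : Prop :=
  [/\ (forall (a : R[i]) (u v w : H), ip (a *: u + v) w = a * ip u w + ip v w),
      (forall u v : H, ip v u = (ip u v)^*%C),
      (forall u : H, 0 <= ip u u),
      (forall u : H, ip u u = 0 -> u = 0)
    & (forall s : nat -> H, cauchy_seq s -> exists x : H, converges_to s x)].

Definition is_projection (p : H -> H) : Prop :=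
  [/\ (forall (a : R[i]) (u v : H), p (a *: u + v) = a *: p u + p v),
      (forall u : H, p (p u) = p u)
    & (forall u v : H, ip (p u) v = ip u (p v))].

Definition is_subspace (S : H -> Prop) : Prop :=
  S 0 /\ (forall (a : R[i]) (u v : H), S u -> S v -> S (a *: u + v)).

Definition is_closed (S : H -> Prop) : Prop :=
  forall (s : nat -> H) (x : H), (forall m, S (s m)) -> converges_to s x -> S x.

Definition dim_le (d : nat) (S : H -> Prop) : Prop :=
  forall vs : 'I_d.+1 -> H, (forall i, S (vs i)) ->
    exists c : 'I_d.+1 -> R[i], (exists i, c i != 0) /\ \sum_i c i *: vs i = 0.

End Hilbert.

(* A unital *-representation of the universal C*-algebra C*(Q_n) on the
   Hilbert space (H, ip) is (by the universal property) the same as a family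
   of projections P x = rho(p_x), x a vertex, satisfying the defining
   relations. *)
Definition is_rep_Qn (n : nat) (R : realType) (H : lmodType R[i])
    (ip : H -> H -> R[i]) (P : 'I_(2 ^ n) -> H -> H) : Prop :=
  [/\ (forall x, is_projection ip (P x)),
      (forall v : H, \sum_(u < 2 ^ n | inU u) P u v = v),
      (forall v : H, \sum_(w < 2 ^ n | inV w) P w v = v)
    & (forall u w : 'I_(2 ^ n), inU u -> inV w -> ~ adjacent u w ->
         forall v : H, P u (P w v) = 0)].

(* The representation is irreducible: H <> 0 and the only closed subspaces
   of H invariant under rho(C*(Q_n)) (equivalently, under the generating
   self-adjoint projections) are 0 and H. *)
Definition irreducible_rep (n : nat) (R : realType) (H : lmodType R[i])
    (ip : H -> H -> R[i]) (P : 'I_(2 ^ n) -> H -> H) : Prop :=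
  (exists v : H, v != 0) /\
  (forall S : H -> Prop, is_subspace S -> is_closed ip S ->
     (forall x v, S v -> S (P x v)) ->
     (forall v, S v) \/ (forall v, S v -> v = 0)).

(* Main.v *)
(* Let x#k be the vertex x with digit k flipped.  Expanding p_x p_y = 0, with
   y = x#k#l and k <> l, over the common neighbours of x and y gives
     p_x p_{x#k} p_{x#k#l} = - p_x p_{x#l} p_{x#l#k}.
   Hence, up to sign, the product of projections along a closed walk at x is a
   product of loops p_x p_{x#k} p_x.  The same relation shows that
   W_k = sum_(u in U) p_u p_{u#k} p_u is central, with
   p_x W_k = p_x p_{x#k} p_x for every vertex x.  In an irreducible
   representation the self-adjoint W_k is a scalar by Schur's lemma, so all the
   corners p_x A p_x are scalar, which forces rank p_x <= 1; and the 2^(n-1)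
   projections p_u, u in U, sum to 1.

   Schur's lemma for a self-adjoint T: choose a real r with <(T - r)v, v> = 0
   for some v <> 0, and rescale S = T - r to a contraction.  If B is the
   positive root of S^2, then (B - S)(B + S) = 0, so irreducibility makes S or
   -S positive; then <Sv, v> = 0 gives Sv = 0, and the closed invariant subspace
   ker S is everything. *)
Require Import Defs.
From HB Require Import structures.
From mathcomp Require Import all_boot all_order all_algebra reals complex boolp.
From mathcomp Require Import ring lra.
Import Order.TTheory GRing.Theory Num.Theory.
Local Open Scope ring_scope.

Set Implicit Arguments.
Unset Strict Implicit.
Unset Printing Implicit Defensive.

(** * Linear maps as bare functions *)

Definition linop (K : pzRingType) (E : lmodType K) (Q : E -> E) : Prop :=
  forall (a : K) (u v : E), Q (a *: u + v) = a *: Q u + Q v.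

Section LinearOperators.
Variables (K : pzRingType) (E : lmodType K) (Q : E -> E).
Hypothesis linQ : linop Q.

Let F : {linear E -> E} := HB.pack Q (GRing.isLinear.Build K E E *:%R Q linQ).

Lemma linop0 : Q 0 = 0.
Proof. exact: (linear0 F). Qed.

Lemma linopD u v : Q (u + v) = Q u + Q v.
Proof. exact: (linearD F). Qed.

Lemma linopB u v : Q (u - v) = Q u - Q v.
Proof. exact: (linearB F). Qed.

Lemma linopN u : Q (- u) = - Q u.
Proof. exact: (linearN F). Qed.

Lemma linopZ a u : Q (a *: u) = a *: Q u.
Proof. exact: (linearZ_LR F). Qed.

Lemma linop_sum (I : Type) (r : seq I) (A : pred I) (f : I -> E) :
  Q (\sum_(i <- r | A i) f i) = \sum_(i <- r | A i) Q (f i).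
Proof. exact: (linear_sum F). Qed.

End LinearOperators.

(** * Real inner product, norm and closed subspaces of a complex Hilbert space *)

Section InnerProduct.
Variables (R : realType) (H : lmodType R[i]) (ip : H -> H -> R[i]).
Hypothesis hilb : is_hilbert ip.

Local Notation "r %:C" := (r%:C)%C : ring_scope.

Lemma ipDl u v w : ip (u + v) w = ip u w + ip v w.
Proof. by case: hilb => h _ _ _ _; rewrite -[u]scale1r h mul1r scale1r. Qed.

Lemma ip0l w : ip 0 w = 0.
Proof. by have /eqP := ipDl 0 0 w; rewrite addr0 -subr_eq subrr => /eqP. Qed.

Lemma ipZl a u w : ip (a *: u) w = a * ip u w.
Proof. by case: hilb => h _ _ _ _; rewrite -[a *: u]addr0 h ip0l addr0. Qed.

Lemma ipC u v : ip v u = (ip u v)^*%C.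
Proof. by case: hilb. Qed.

Lemma ipZr a u w : ip u (a *: w) = a^*%C * ip u w.
Proof. by rewrite ipC ipZl rmorphM /= -ipC. Qed.

Lemma ip_eq0 u : ip u u = 0 -> u = 0.
Proof. by case: hilb => _ _ _ h _; apply: h. Qed.

Lemma ip_self u : ip u u = (nrm2 ip u)%:C.
Proof.
case: hilb => _ _ h _ _.
by rewrite /nrm2 [LHS]complexE (ger0_Im (h u)) mulr0 addr0.
Qed.

(** Taking real parts makes [H] a real inner product space, so estimates stay in the ordered field
    [R]. *)
Definition rip u v : R := complex.Re (ip u v).
Definition nrm u : R := Num.sqrt (nrm2 ip u).

Lemma ripC u v : rip v u = rip u v.
Proof. by rewrite /rip ipC; case: (ip u v). Qed.

Lemma ripDl u v w : rip (u + v) w = rip u w + rip v w.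
Proof. by rewrite /rip ipDl raddfD. Qed.

Lemma ripDr u v w : rip w (u + v) = rip w u + rip w v.
Proof. by rewrite ripC ripDl !(ripC w). Qed.

Lemma ripZl (r : R) u w : rip (r%:C *: u) w = r * rip u w.
Proof. by rewrite /rip ipZl; case: (ip u w) => a b /=; ring. Qed.

Lemma ripZr (r : R) u w : rip u (r%:C *: w) = r * rip u w.
Proof. by rewrite ripC ripZl ripC. Qed.

Lemma ripNl u w : rip (- u) w = - rip u w.
Proof.
apply/eqP; rewrite -addr_eq0 -ripDl addNr; apply/eqP.
by rewrite /rip ip0l.
Qed.

Lemma ripNr u w : rip u (- w) = - rip u w.
Proof. by rewrite ripC ripNl ripC. Qed.

Lemma rip_ge0 u : 0 <= rip u u.
Proof. by case: hilb => _ _ /(_ u) + _ _; rewrite lecE => /andP[]. Qed.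

Lemma nrm_ge0 u : 0 <= nrm u.
Proof. exact: sqrtr_ge0. Qed.

Lemma nrm_sqr u : nrm u ^+ 2 = rip u u.
Proof. by rewrite sqr_sqrtr // rip_ge0. Qed.

Lemma nrm0_eq0 u : nrm u = 0 -> u = 0.
Proof.
move=> h; apply: ip_eq0; rewrite ip_self.
by move: (nrm_sqr u); rewrite h expr0n /= /rip -/(nrm2 ip u) => <-.
Qed.

Lemma nrm_le u v : (nrm u <= nrm v) = (rip u u <= rip v v).
Proof. by rewrite -!nrm_sqr ler_sqr ?nnegrE ?nrm_ge0. Qed.

Lemma nrm0 : nrm 0 = 0.
Proof. by rewrite /nrm /nrm2 ip0l sqrtr0. Qed.

Lemma rip_le u v : rip u v <= nrm u * nrm v.
Proof.
have [u0|u0] := eqVneq (nrm u) 0.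
  by rewrite u0 mul0r (nrm0_eq0 u0) /rip ip0l.
have [v0|v0] := eqVneq (nrm v) 0.
  by rewrite v0 mulr0 (nrm0_eq0 v0) ripC /rip ip0l.
have := rip_ge0 ((nrm v)%:C *: u - (nrm u)%:C *: v).
rewrite !(ripDl, ripDr, ripNl, ripNr, ripZl, ripZr) -!nrm_sqr (ripC u v).
have a0 : 0 < nrm u by rewrite lt_def u0 nrm_ge0.
have b0 : 0 < nrm v by rewrite lt_def v0 nrm_ge0.
have ab0 : 0 < nrm u * nrm v by rewrite mulr_gt0.
move: (rip u v) => g h; rewrite -(ler_pM2l ab0); lra.
Qed.

Lemma nrmD u v : nrm (u + v) <= nrm u + nrm v.
Proof.
rewrite -ler_sqr ?nnegrE ?addr_ge0 ?nrm_ge0 // nrm_sqr ripDl !ripDr (ripC u v).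
have := rip_le u v; rewrite -!nrm_sqr; lra.
Qed.

Lemma nrmZ (a : R[i]) u : nrm (a *: u) = Normc.normc a * nrm u.
Proof.
rewrite /nrm /nrm2 ipZl ipZr ip_self; case: a => x y /=.
by rewrite -sqrtrM ?addr_ge0 ?sqr_ge0 //; congr Num.sqrt; ring.
Qed.

Lemma nrmZr (r : R) u : nrm (r%:C *: u) = `|r| * nrm u.
Proof. by rewrite nrmZ /= expr0n addr0 sqrtr_sqr. Qed.

Lemma nrmN u : nrm (- u) = nrm u.
Proof. by rewrite -scaleN1r nrmZ normcN Normc.normc1 mul1r. Qed.

Lemma nrmB u v : nrm (u - v) <= nrm u + nrm v.
Proof. by rewrite -(nrmN v) nrmD. Qed.

Lemma nrm_distC u v : nrm (u - v) = nrm (v - u).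
Proof. by rewrite -nrmN opprB. Qed.

Lemma nrm2_lt u (e : R) : 0 < e -> (nrm2 ip u < e ^+ 2) = (nrm u < e).
Proof.
by move=> e0; rewrite -[nrm2 ip u]nrm_sqr ltr_sqr ?nnegrE ?nrm_ge0 ?ltW.
Qed.

(** If [x] were positive, [e = 1] would force [C > 0], and then [e = x / (2 * C)] would give
    [x <= x / 2]. *)
Lemma le0_small (x C : R) : (forall e, 0 < e -> x <= e * C) -> x <= 0.
Proof.
move=> h; rewrite leNgt; apply/negP => x0.
have C0 : 0 < C by have := h 1 ltr01; lra.
have := h (x / (2 * C)) (divr_gt0 x0 (mulr_gt0 (ltr0Sn R 1) C0)).
have -> : x / (2 * C) * C = x / 2 by field; lra.
lra.
Qed.

Lemma nrm_small u (C : R) : (forall e, 0 < e -> nrm u <= e * C) -> u = 0.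
Proof.
move=> /le0_small h; apply: nrm0_eq0; apply/eqP.
by rewrite eq_le h nrm_ge0.
Qed.

Definition bounded (Q : H -> H) : Prop :=
  exists2 C : R, 0 <= C & forall v, nrm (Q v) <= C * nrm v.

Lemma ker_closed (Q : H -> H) : linop Q -> bounded Q ->
  is_closed ip (fun v => Q v = 0).
Proof.
move=> linQ [C C0 hC] s x s0 sx; apply: (@nrm_small _ C) => e e0.
have e20 : 0 < e ^+ 2 by rewrite exprn_gt0.
have [N /(_ N (leqnn N))] := sx _ e20; rewrite nrm2_lt // => he.
have -> : Q x = - Q (s N - x) by rewrite linopB // s0 sub0r opprK.
by rewrite nrmN mulrC; apply: le_trans (hC _) _; rewrite ler_wpM2l // ltW.
Qed.

(** Replacing [x] by [x - s N] shows [rip (c *: x) w <= 0] for every complex [c]. Using both [b] and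
    [- b] turns this into an equality, and [b = 1], [b = 'i] recover the two parts of [ip x w]. *)
Lemma orth_closed (A : H -> Prop) :
  is_closed ip (fun z => forall w, A w -> ip z w = 0).
Proof.
move=> s x s0 sx w Aw.
have re0 b : rip (b *: x) w = 0.
  suff h c : rip (c *: x) w <= 0.
    apply/eqP; rewrite eq_le h -oppr_le0 -ripNl -scaleNr h //.
  apply: (@le0_small _ (Normc.normc c * nrm w)) => e e0.
  have [N /(_ N (leqnn N))] := sx _ (exprn_gt0 2 e0).
  rewrite nrm2_lt // => he.
  have -> : rip (c *: x) w = rip (c *: (x - s N)) w.
    by rewrite scalerBr ripDl ripNl {3}/rip ipZl s0 // mulr0 subr0.
  have c0 : 0 <= Normc.normc c by case: (c) => a d; rewrite sqrtr_ge0.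
  rewrite mulrA [e * _]mulrC; apply: le_trans (rip_le _ _) _.
  by rewrite nrmZ nrm_distC ler_wpM2r ?nrm_ge0 // ler_wpM2l // ltW.
have := re0 1; have := re0 'i%C; rewrite scale1r /rip ipZl.
by case: (ip x w) => a b /=; rewrite mul0r mul1r add0r => /eqP; rewrite oppr_eq0 => /eqP -> ->.
Qed.

End InnerProduct.

(** * Square root of [1 - X] for a contraction [X], by iteration *)

Section SquareRoot.
Variables (R : realType) (H : lmodType R[i]) (ip : H -> H -> R[i]).
Hypothesis hilb : is_hilbert ip.

Local Notation "r %:C" := (r%:C)%C : ring_scope.
Local Notation nrm := (nrm ip).
Local Notation rip := (rip ip).

(* The iteration y |-> (x + y ^ 2) / 2 for y = 1 - sqrt (1 - x): evaluated at
   the number 1 it bounds the norm of its evaluation at any contraction,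
   because it only involves polynomials with nonnegative coefficients. *)
Fixpoint root_bound (k : nat) : R :=
  if k is j.+1 then 2^-1 * (1 + root_bound j ^+ 2) else 0.

Fixpoint root_iter (X : H -> H) (k : nat) (v : H) : H :=
  if k is j.+1 then (2^-1)%:C *: (X v + root_iter X j (root_iter X j v))
  else 0.

Lemma root_bound01 k : 0 <= root_bound k <= 1.
Proof.
elim: k => [|k /andP[h0 h1]] /=; first by rewrite lexx ler01.
have := mulr_ge0 h0 h0; have := ler_pM h0 h0 h1 h1.
rewrite mulr1 -expr2; lra.
Qed.

(** The increment is [(1 - root_bound k) ^+ 2 / 2]. *)
Lemma root_bound_le k : root_bound k <= root_bound k.+1.
Proof.
move: (root_bound01 k) => /= ?; have := sqr_ge0 (1 - root_bound k).
by move: (root_bound k) => b; rewrite sqrrB; lra.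
Qed.

(** Any [N] whose value is within [e] of the supremum works. *)
Lemma root_bound_cauchy (e : R) : 0 < e ->
  exists N, forall m, (N <= m)%N -> root_bound m - root_bound N < e.
Proof.
move=> e0; pose A : classical_sets.set R := fun r => exists k, r = root_bound k.
have supA : classical_sets.has_sup A.
  split; first by exists 0, 0%N.
  by exists 1 => _ [k ->]; have /andP[] := root_bound01 k.
have [_ [N ->] hN] := sup_adherent e0 supA.
exists N => m _; have := sup_upper_bound supA (ex_intro _ m erefl : A (root_bound m)).
by move: hN; lra.
Qed.

Section Iteration.
Variable X : H -> H.
Hypothesis linX : linop X.
Hypothesis contrX : forall v, nrm (X v) <= nrm v.

Local Notation Y := (root_iter X).
Local Notation t := root_bound.

Lemma linop_root_iter k : linop (Y k).
Proof.
elim: k => [|k IH] a u v /=; first by rewrite scaler0 addr0.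
rewrite linX !IH addrACA -scalerDr [LHS]scalerDr; congr (_ + _).
by rewrite !scalerA mulrC.
Qed.

Lemma root_iter_comm (Q : H -> H) k : linop Q ->
  (forall v, Q (X v) = X (Q v)) -> forall v, Q (Y k v) = Y k (Q v).
Proof.
move=> linQ QX; elim: k => [|k IH] v /=; first exact: linop0.
by rewrite linopZ // linopD // QX !IH.
Qed.

Lemma nrm_half v : nrm ((2^-1)%:C *: v) = 2^-1 * nrm v.
Proof. by rewrite nrmZr // ger0_norm // invr_ge0 ler0n. Qed.

Lemma root_iter_nrm k v : nrm (Y k v) <= t k * nrm v.
Proof.
elim: k v => [|k IH] v /=; first by rewrite nrm0 // mul0r.
rewrite nrm_half -mulrA ler_wpM2l ?invr_ge0 ?ler0n // mulrDl mul1r.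
apply: le_trans (nrmD hilb _ _) _; apply: lerD (contrX v) _.
apply: le_trans (IH _) _; rewrite expr2 -mulrA ler_wpM2l //.
by have /andP[] := root_bound01 k.
Qed.

(** Induction on [Y'^2 - Y^2 = Y' (Y' - Y) + (Y' - Y) Y] for consecutive iterates [Y], [Y']; the
    scalar sequence satisfies the same identity, so the bounds match term by term. *)
Lemma root_iter_step k v :
  nrm (Y k.+1 v - Y k v) <= (t k.+1 - t k) * nrm v.
Proof.
elim: k v => [|k IH] v.
  rewrite /= addr0 !subr0 expr0n addr0 mulr1 nrm_half.
  by rewrite ler_wpM2l ?invr_ge0 ?ler0n.
have -> : Y k.+2 v - Y k.+1 v = (2^-1)%:C *:
    (Y k.+1 (Y k.+1 v - Y k v) + (Y k.+1 (Y k v) - Y k (Y k v))).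
  rewrite (linopB (linop_root_iter k.+1)) addrA subrK.
  rewrite [Y k.+2 v]/= [Y k.+1 v in LHS]/= -scalerBr; congr (_ *: _).
  by rewrite opprD addrACA subrr add0r.
rewrite nrm_half.
have -> : t k.+2 - t k.+1 = 2^-1 * (t k.+1 * (t k.+1 - t k) + (t k.+1 - t k) * t k).
  have tS j : t j.+1 = 2^-1 * (1 + t j ^+ 2) by [].
  by rewrite (tS k.+1) {2}(tS k); field.
rewrite -[leRHS]mulrA ler_wpM2l ?invr_ge0 ?ler0n // mulrDl.
apply: le_trans (nrmD hilb _ _) _; apply: lerD.
  apply: le_trans (root_iter_nrm _ _) _; rewrite -mulrA ler_wpM2l //.
  by have /andP[] := root_bound01 k.+1.
apply: le_trans (IH _) _; rewrite -mulrA ler_wpM2l ?root_iter_nrm //.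
by rewrite subr_ge0 root_bound_le.
Qed.

Lemma root_iter_dist j k v : (j <= k)%N ->
  nrm (Y k v - Y j v) <= (t k - t j) * nrm v.
Proof.
move=> /subnK <-; elim: (k - j)%N => [|d IH]; first by rewrite !subrr nrm0 // mul0r.
rewrite addSn -[Y _.+1 v](subrK (Y (d + j)%N v)) -addrA.
apply: le_trans (nrmD hilb _ _) _.
have := root_iter_step (d + j) v; move: IH; rewrite !mulrBl; lra.
Qed.

Lemma root_iter_cvg v : exists w, converges_to ip (Y ^~ v) w.
Proof.
case: hilb => _ _ _ _; apply=> e e0.
(* Two distances of at most [d * nrm v] must add up to less than [Num.sqrt e], as [nrm2] is a
   squared norm; the [+ 1] covers [nrm v = 0]. *)
pose d := Num.sqrt e / (2 * (nrm v + 1)).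
have n0 := nrm_ge0 ip v.
have s0 : 0 < Num.sqrt e by rewrite sqrtr_gt0.
have d0 : 0 < d by rewrite divr_gt0 //; lra.
have [N hN] := root_bound_cauchy d0; exists N => m k Nm Nk.
rewrite -[e in _ < e]sqr_sqrtr ?ltW // nrm2_lt //.
rewrite -(subrK (Y N v) (Y m v)) -addrA; apply: le_lt_trans (nrmD hilb _ _) _.
rewrite (nrm_distC hilb (Y N v)).
have h1 := root_iter_dist v Nm; have h2 := root_iter_dist v Nk.
have {h1} : nrm (Y m v - Y N v) <= d * nrm v.
  by apply: le_trans h1 _; rewrite ler_wpM2r // ltW // hN.
have {h2} : nrm (Y k v - Y N v) <= d * nrm v.
  by apply: le_trans h2 _; rewrite ler_wpM2r // ltW // hN.
have : d * (2 * (nrm v + 1)) = Num.sqrt e by rewrite /d divfK //; lra.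
by move: d0; rewrite -/d; move: (d) => d'; lra.
Qed.

(** Here [B] is [1] minus the pointwise limit of the iterates. The bounds are uniform relative to
    [nrm v], and one [k] serves both, so every property of [B] can be passed on from the polynomials
    [1 - Y k] in [X]. *)
Lemma root_iter_approx : exists B : H -> H, forall e, 0 < e -> exists k,
  (forall v, nrm (B v - (v - Y k v)) <= e * nrm v) /\
  (forall v, nrm ((v - Y k v) - Y k (v - Y k v) - (v - X v)) <= e * nrm v).
Proof.
have [L hL] := choice root_iter_cvg.
exists (fun v => v - L v) => e e0.
have [N hN] := @root_bound_cauchy (e / 2) (divr_gt0 e0 (ltr0Sn R 1)).
exists N; split => v.
  have -> : v - L v - (v - Y N v) = - (L v - Y N v).
    by rewrite !opprB addrC addrA subrK.
  rewrite nrmN // -subr_le0; apply: (@le0_small R _ 1) => d d0; rewrite mulr1.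
  have [M hM] := hL v _ (exprn_gt0 2 d0).
  pose m := maxn M N.
  have := hM m (leq_maxl _ _); rewrite nrm2_lt // (nrm_distC hilb) => h1.
  have h2 := root_iter_dist v (leq_maxr M N).
  have h3 := hN m (leq_maxr M N).
  have h4 : nrm (L v - Y N v) <= nrm (L v - Y m v) + nrm (Y m v - Y N v).
    by rewrite -{1}(subrK (Y m v) (L v)) -addrA nrmD.
  have h5 : (t m - t N) * nrm v <= e / 2 * nrm v.
    by rewrite ler_wpM2r ?nrm_ge0 // ltW.
  have := mulr_ge0 (ltW e0) (nrm_ge0 ip v); move: h1 h2 h4 h5; rewrite -/m.
  lra.
(* Expanded, [(1 - Y)^2 - (1 - X) = X + Y^2 - 2 Y], which is twice one step of the iteration; hence
   the earlier choice of [e / 2]. *)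
have -> : v - Y N v - Y N (v - Y N v) - (v - X v) = 2%:R *: (Y N.+1 v - Y N v).
  rewrite (linopB (linop_root_iter N)) /= scalerBr scalerA.
  have -> : 2%:R * (2^-1)%:C = 1 :> R[i].
    by rewrite -[2%:R](rmorph_nat (real_complex R)) -rmorphM mulfV ?rmorph1 ?pnatr_eq0.
  rewrite scale1r scaler_nat mulr2n !opprB [v - _ + (_ - _)]addrACA -opprD [_ + (X v - v)]addrAC.
  by rewrite [v + _ + _]addrC [X v - v + _]addrA subrK.
rewrite -[2%:R](rmorph_nat (real_complex R)) nrmZr // normr_nat.
have := root_iter_step N v; have := hN N.+1 (leqnSn N) => h1 h2.
have : (t N.+1 - t N) * nrm v <= e / 2 * nrm v by rewrite ler_wpM2r ?nrm_ge0 // ltW.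
lra.
Qed.

End Iteration.

End SquareRoot.

(** * Positive square roots and Schur's lemma for self-adjoint operators *)

Section SchurLemma.
Variables (R : realType) (H : lmodType R[i]) (ip : H -> H -> R[i]).
Hypothesis hilb : is_hilbert ip.

Local Notation "r %:C" := (r%:C)%C : ring_scope.
Local Notation nrm := (nrm ip).
Local Notation rip := (rip ip).

(** Each property is inherited from [1 - Y k] up to an error proportional to [e]. Positivity comes
    from [nrm (Y k v) <= nrm v]; for commutation, boundedness of [Q] keeps the error small. *)
Lemma positive_root (X : H -> H) :
  linop X -> (forall v, nrm (X v) <= nrm v) ->
  exists B : H -> H, [/\ linop B, bounded ip B,
    forall v, 0 <= rip (B v) v, forall v, B (B v) = v - X v &
    forall Q, linop Q -> bounded ip Q -> (forall v, Q (X v) = X (Q v)) ->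
      forall v, Q (B v) = B (Q v)].
Proof.
move=> linX contrX; have [B hB] := root_iter_approx hilb linX contrX.
have linZ k : linop (fun v => v - root_iter X k v).
  move=> a u v; rewrite (linop_root_iter linX) opprD addrACA.
  by rewrite scalerBr.
have leZ k v : nrm (v - root_iter X k v) <= 2 * nrm v.
  apply: le_trans (nrmB hilb _ _) _; rewrite mulr2n mulrDl mul1r lerD2l.
  apply: le_trans (root_iter_nrm hilb contrX _ _) _.
  by rewrite ler_piMl ?nrm_ge0 //; have /andP[] := root_bound01 R k.
exists B; split.
- move=> a u v; apply/eqP; rewrite -subr_eq0; apply/eqP.
  apply: (nrm_small hilb (C := nrm (a *: u + v) + (Normc.normc a * nrm u + nrm v))).
  move=> e /hB[k [hk _]].
  pose Z w := w - root_iter X k w; have linZk : linop Z := linZ k.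
  have -> : B (a *: u + v) - (a *: B u + B v) =
      (B (a *: u + v) - Z (a *: u + v))
      - (a *: (B u - Z u) + (B v - Z v)).
    rewrite scalerBr addrACA -opprD -linZk; move: (Z _) => z.
    by rewrite opprB addrA subrK.
  apply: le_trans (nrmB hilb _ _) _; rewrite mulrDr; apply: lerD (hk _) _.
  apply: le_trans (nrmD hilb _ _) _; rewrite mulrDr; apply: lerD (hk _).
  rewrite nrmZ // mulrCA ler_wpM2l //.
  by case: (a) => x y; rewrite sqrtr_ge0.
(* With [e = 1], the distance from [B] to [1 - Y k] contributes 1 and the norm of [1 - Y k] at most
   2. *)
- exists 3; first by rewrite ler0n.
  move=> v; have [k [/(_ v) hk _]] := hB 1 ltr01.
  rewrite -(subrK (v - root_iter X k v) (B v)).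
  apply: le_trans (nrmD hilb _ _) _; have := leZ k v; lra.
- move=> v; rewrite -oppr_le0; apply: (@le0_small R _ (rip v v)).
  move=> e /hB[k [/(_ v) hk _]].
  have -> : B v = (B v - (v - root_iter X k v)) + (v - root_iter X k v).
    by rewrite subrK.
  move: (B v - _) hk => D hk; rewrite !ripDl // ripNl //.
  have h1 := rip_le hilb (- D) v.
  have h2 := rip_le hilb (root_iter X k v) v.
  have h3 : nrm (root_iter X k v) * nrm v <= rip v v.
    rewrite -nrm_sqr // expr2 ler_wpM2r ?nrm_ge0 //.
    apply: le_trans (root_iter_nrm hilb contrX _ _) _.
    by rewrite ler_piMl ?nrm_ge0 //; have /andP[] := root_bound01 R k.
  have h4 : nrm (- D) * nrm v <= e * rip v v.
    by rewrite nrmN // -nrm_sqr // expr2 mulrA ler_wpM2r ?nrm_ge0.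
  move: h1; rewrite ripNl //; lra.
- move=> v; apply/eqP; rewrite -subr_eq0; apply/eqP.
  apply: (nrm_small hilb (C := nrm (B v) + (2 * nrm v + nrm v))).
  move=> e e0; have [k [hk1 hk2]] := hB e e0.
  pose Z u := u - root_iter X k u.
  have -> : B (B v) - (v - X v) =
      (B (B v) - Z (B v)) + (Z (B v - Z v) + (Z (Z v) - (v - X v))).
    have linZk : linop Z := linZ k.
    rewrite (linopB linZk); move: (Z (B v)) (Z (Z v)) => p q.
    by rewrite !addrA subrK subrK.
  apply: le_trans (nrmD hilb _ _) _; rewrite mulrDr; apply: lerD (hk1 _) _.
  apply: le_trans (nrmD hilb _ _) _; rewrite mulrDr; apply: lerD (hk2 _).
  apply: le_trans (leZ _ _) _; rewrite mulrCA ler_wpM2l ?ler0n //.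
- move=> Q linQ [C C0 hC] QX v; apply/eqP; rewrite -subr_eq0; apply/eqP.
  apply: (nrm_small hilb (C := C * nrm v + nrm (Q v))).
  move=> e e0; have [k [hk1 _]] := hB e e0.
  have -> : Q (B v) - B (Q v) = Q (B v - (v - root_iter X k v))
      - (B (Q v) - (Q v - root_iter X k (Q v))).
    rewrite !(linopB linQ) (root_iter_comm k linQ QX); move: (Q v - _) => q.
    by rewrite opprB addrA subrK.
  apply: le_trans (nrmB hilb _ _) _; rewrite mulrDr; apply: lerD (hk1 _).
  by apply: le_trans (hC _) _; rewrite mulrCA ler_wpM2l.
Qed.

Section IrreducibleFamily.
Variables (I : Type) (P : I -> H -> H).
Hypothesis linP : forall i, linop (P i).
Hypothesis bndP : forall i, bounded ip (P i).
Hypothesis irrP : forall S : H -> Prop, is_subspace S -> is_closed ip S ->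
  (forall i v, S v -> S (P i v)) -> (forall v, S v) \/ (forall v, S v -> v = 0).

Lemma ker_trivial (Q : H -> H) : linop Q -> bounded ip Q ->
  (forall i v, P i (Q v) = Q (P i v)) ->
  (forall v, Q v = 0) \/ (forall v, Q v = 0 -> v = 0).
Proof.
move=> linQ bndQ PQ; apply: irrP.
- split=> [|a u v u0 v0]; first exact: linop0.
  by rewrite linQ u0 v0 scaler0 addr0.
- exact: (ker_closed hilb linQ bndQ).
- by move=> i v Qv; rewrite -PQ Qv linop0.
Qed.

Variable T : H -> H.
Hypothesis linT : linop T.
Hypothesis symT : forall u v, rip (T u) v = rip u (T v).
Hypothesis commT : forall i v, P i (T v) = T (P i v).

Lemma definite_of_irreducible : (forall v, nrm (T v) <= nrm v) ->
  (forall v, 0 <= rip (T v) v) \/ (forall v, rip (T v) v <= 0).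
Proof.
(* Then [1 - X = T^2], and [X] is a contraction since [|X v|^2 = |v|^2 - 2 |T v|^2 + |T (T
   v)|^2]. *)
move=> contrT; pose X v := v - T (T v).
have linX : linop X.
  by move=> a u v; rewrite /X !linT opprD addrACA scalerBr.
have contrX v : nrm (X v) <= nrm v.
  rewrite nrm_le // /X !(ripDl, ripDr, ripNl, ripNr) // (ripC hilb v).
  rewrite -symT.
  have := contrT (T v); rewrite nrm_le //; have := rip_ge0 hilb (T v); lra.
have [B [linB [C C0 hC] posB BB commB]] := positive_root linX contrX.
have bndT : bounded ip T by exists 1 => // v; rewrite mul1r.
have TB v : T (B v) = B (T v).
  by apply: commB => // u; rewrite /X linopB.
have [||i v|h|h] := @ker_trivial (fun v => B v - T v).
- by move=> a u v; rewrite linB linT opprD addrACA scalerBr.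
- exists (C + 1) => [|v]; first by rewrite addr_ge0.
  by apply: le_trans (nrmB hilb _ _) _; rewrite mulrDl mul1r lerD.
- by rewrite linopB // commT commB // => u; rewrite /X linopB // !commT.
- by left=> v; have := posB v; rewrite (subr0_eq (h v)).
(* The range of [B + T] lies in the kernel of [B - T], because [B] and [T] commute and
   [B^2 = T^2]. *)
right=> v; have : B v + T v = 0.
  by apply: h; rewrite (linopD linB) (linopD linT) BB TB /X subKr [B _ + _]addrC subrr.
move/eqP; rewrite addr_eq0 => /eqP BT.
by have := posB v; rewrite BT ripNl // oppr_ge0.
Qed.

End IrreducibleFamily.

(** Testing positivity at [v - T v] gives [0 <= - 2 |T v|^2 + rip (T (T v)) (T v)], and the last
    term is at most [|T v|^2]. *)
Lemma positive_eq0 (T : H -> H) v : linop T ->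
  (forall u v, rip (T u) v = rip u (T v)) -> (forall v, nrm (T v) <= nrm v) ->
  (forall v, 0 <= rip (T v) v) -> rip (T v) v = 0 -> T v = 0.
Proof.
move=> linT symT contrT posT v0; apply: (nrm0_eq0 hilb); apply/eqP.
rewrite -sqrf_eq0 eq_le sqr_ge0 andbT nrm_sqr //.
have := posT (v - T v); rewrite linopB // !(ripDl, ripDr, ripNl, ripNr) // v0.
rewrite (symT (T v) v).
have := rip_le hilb (T (T v)) (T v); have := contrT (T v).
move/(ler_wpM2r (nrm_ge0 ip (T v))); rewrite -expr2 nrm_sqr //; lra.
Qed.

Lemma schur (I : Type) (P : I -> H -> H) (T : H -> H) :
  (forall i, linop (P i)) -> (forall i, bounded ip (P i)) ->
  (exists v : H, v != 0) ->
  (forall S : H -> Prop, is_subspace S -> is_closed ip S ->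
     (forall i v, S v -> S (P i v)) ->
     (forall v, S v) \/ (forall v, S v -> v = 0)) ->
  linop T -> bounded ip T -> (forall u v, rip (T u) v = rip u (T v)) ->
  (forall i v, P i (T v) = T (P i v)) ->
  exists r : R[i], forall v, T v = r *: v.
Proof.
move=> linP bndP [v0 v0N] irrP linT [C C0 hC] symT commT.
have n0 : rip v0 v0 != 0.
  rewrite -nrm_sqr // sqrf_eq0; apply: contra v0N => /eqP h.
  by apply/eqP; apply: (nrm0_eq0 hilb).
(* The Rayleigh quotient at [v0] makes the form of [T - r] vanish there; dividing by [d] makes the
   operator a contraction. *)
pose r := rip (T v0) v0 / rip v0 v0; exists r%:C.
pose d := C + `|r| + 1; have d0 : 0 < d by rewrite ltr_wpDl // addr_ge0.
pose S v := (d^-1)%:C *: (T v - r%:C *: v).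
have linS : linop S.
  move=> a u v; rewrite /S linT (scalerDr r%:C) opprD addrACA [LHS]scalerDr.
  congr (_ + _); rewrite (scalerA r%:C) [r%:C * a]mulrC -(scalerA a).
  by rewrite -scalerBr !scalerA [a * _]mulrC.
have contrS v : nrm (S v) <= nrm v.
  rewrite nrmZr // gtr0_norm ?invr_gt0 // ler_pdivrMl //.
  apply: le_trans (nrmB hilb _ _) _; rewrite nrmZr // /d !mulrDl mul1r.
  have := hC v; have := nrm_ge0 ip v; lra.
have symS u v : rip (S u) v = rip u (S v).
  by rewrite /S !(ripZl, ripZr, ripDl, ripDr, ripNl, ripNr) // symT.
have commS i v : P i (S v) = S (P i v).
  by rewrite /S linopZ // linopB // linopZ // commT.
have Sv0 : rip (S v0) v0 = 0.
  by rewrite /S ripZl // ripDl // ripNl // ripZl // /r divfK // subrr mulr0.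
have S0 : S v0 = 0.
  have [h|h] := definite_of_irreducible linP bndP irrP linS symS commS contrS.
    exact: positive_eq0.
  suff : - S v0 = 0 by move/eqP; rewrite oppr_eq0 => /eqP.
  apply: (@positive_eq0 (fun v => - S v)).
  - by move=> a u v; rewrite linS opprD scalerN.
  - by move=> u v; rewrite ripNl // ripNr // symS.
  - by move=> v; rewrite nrmN.
  - by move=> v; rewrite ripNl // oppr_ge0.
  - by rewrite ripNl // Sv0 oppr0.
have bndS : bounded ip S by exists 1 => // v; rewrite mul1r.
(* The kernel of [S] contains [v0], which is nonzero, so it must be all of [H]. *)
have [h|h] := ker_trivial linP irrP linS bndS commS; last first.
  by rewrite (h _ S0) eqxx in v0N.
move=> v; have /eqP := h v; rewrite scaler_eq0 subr_eq0 => /orP[|/eqP//].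
by rewrite (inj_eq (@complexI R)) invr_eq0 gt_eqF.
Qed.

End SchurLemma.

(** * Binary digits and digit flips *)

Lemma bit_half i k : bit i k.+1 = bit i./2 k.
Proof. by rewrite /bit expnS divnMA divn2. Qed.

Lemma bit_inj n i j : (i < 2 ^ n)%N -> (j < 2 ^ n)%N ->
  (forall m, (m < n)%N -> bit i m = bit j m) -> i = j.
Proof.
elim: n i j => [|n IH] i j; first by rewrite expn0 !ltnS !leqn0 => /eqP-> /eqP->.
rewrite expnS mul2n => lti ltj h.
have := h 0%N (ltn0Sn n); rewrite /bit expn0 !divn1 => odd_ij.
rewrite -(odd_double_half i) -(odd_double_half j) odd_ij (IH i./2 j./2) //.
- by rewrite ltn_half_double.
- by rewrite ltn_half_double.
- by move=> m ltm; rewrite -!bit_half h.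
Qed.

Definition flip_quot (q : nat) : nat := if odd q then q.-1 else q.+1.

Lemma flipE i k : flip i k = (flip_quot (i %/ 2 ^ k) * 2 ^ k + i %% 2 ^ k)%N.
Proof.
rewrite /flip /bit /flip_quot {2 3}(divn_eq i (2 ^ k)).
case: ifP => [|_]; last by rewrite mulSn addnAC [(2 ^ k + _)%N]addnC.
case: (i %/ 2 ^ k)%N => // q _ /=.
by rewrite mulSn -addnA addKn.
Qed.

Lemma half_flip_quot q : (flip_quot q)./2 = q./2.
Proof.
rewrite /flip_quot; move: (odd_double_half q); move: (q./2) => h.
by case: (odd q) => <-; rewrite ?add1n ?add0n /= ?doubleK ?uphalf_double.
Qed.

(** Split at [2 ^ k]: digits below [k] depend on the remainder, which is untouched; digits above [k]
    depend on the half of the quotient, which [flip_quot] preserves; digit [k] is the parity of the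
    quotient. *)
Lemma bit_flip i k m : bit (flip i k) m = bit i m (+) (m == k).
Proof.
rewrite flipE /bit; set q := (i %/ 2 ^ k)%N; set r := (i %% 2 ^ k)%N.
have ltr : (r < 2 ^ k)%N by rewrite ltn_pmod // expn_gt0.
have iE : i = (q * 2 ^ k + r)%N by rewrite /q /r -divn_eq.
have low p : (m < k)%N -> odd ((p * 2 ^ k + r) %/ 2 ^ m) = odd (r %/ 2 ^ m).
  move=> ltmk; rewrite -(subnK (ltnW ltmk)) expnD mulnA divnMDl ?expn_gt0 //.
  by rewrite oddD oddM oddX subn_eq0 leqNgt ltmk /= andbF.
have high p : (k <= m)%N -> ((p * 2 ^ k + r) %/ 2 ^ m = p %/ 2 ^ (m - k))%N.
  move=> lekm; rewrite -{1}(subnKC lekm) expnD divnMA divnMDl ?expn_gt0 //.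
  by rewrite (divn_small ltr) addn0.
rewrite {1}iE; case: (ltngtP m k) => [lt|lt|mk].
- by rewrite !low // addbF.
- rewrite !high ?(ltnW lt) // addbF -(subnSK lt) expnS !divnMA !divn2.
  by rewrite half_flip_quot.
- rewrite !high ?mk // subnn expn0 !divn1 /flip_quot addbT.
  by case: ifP => //=; case: (q) => //= p; case: odd.
Qed.

Lemma flip_lt n i k : (i < 2 ^ n)%N -> (k < n)%N -> (flip i k < 2 ^ n)%N.
Proof.
move=> lti ltk; rewrite flipE -(subnK (ltnW ltk)) expnD.
have ltr : (i %% 2 ^ k < 2 ^ k)%N by rewrite ltn_pmod // expn_gt0.
have ltq : (flip_quot (i %/ 2 ^ k) < 2 ^ (n - k))%N.
  have h : (i %/ 2 ^ k < 2 ^ (n - k))%N.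
    by rewrite ltn_divLR ?expn_gt0 // -expnD subnK // ltnW.
  rewrite /flip_quot; case: ifP => [_|evq]; first exact: leq_ltn_trans (leq_pred _) h.
  (* An even quotient has an odd successor, which cannot equal [2 ^ (n - k)], even because
     [k < n]. *)
  rewrite ltn_neqAle h andbT; apply/eqP => /(congr1 odd).
  by rewrite /= evq oddX subn_eq0 leqNgt ltk.
apply: (@leq_trans ((flip_quot (i %/ 2 ^ k)).+1 * 2 ^ k)).
  by rewrite mulSn addnC ltn_add2r.
by rewrite leq_mul2r ltq orbT.
Qed.

Lemma par_flip n i k : (k < n)%N -> par n (flip i k) = ~~ par n i.
Proof.
move=> ltk.
have parE j : par n j = \big[addb/false]_(m < n) bit j m.
  rewrite /par (big_morph odd oddD (erefl : odd 0 = false)).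
  by apply: eq_bigr => m _; rewrite oddb.
rewrite !parE (bigD1 (Ordinal ltk)) //= [in RHS](bigD1 (Ordinal ltk)) //=.
rewrite bit_flip eqxx addbT addNb; congr (~~ (_ (+) _)).
apply: eq_bigr => m neq; rewrite bit_flip.
by rewrite (_ : (m == k :> nat) = false) ?addbF //; apply: contraNF neq.
Qed.

(** * Combinatorics of the hypercube *)

Section Cube.
Variable n : nat.
Implicit Types (x y : 'I_(2 ^ n)) (k l : 'I_n).

Definition flip_ord x k : 'I_(2 ^ n) := Ordinal (flip_lt (ltn_ord x) (ltn_ord k)).

Lemma ord_bit_inj x y : (forall m : 'I_n, bit x m = bit y m) -> x = y.
Proof.
move=> h; apply: val_inj; apply: bit_inj (ltn_ord x) (ltn_ord y) _ => m ltm.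
exact: (h (Ordinal ltm)).
Qed.

Lemma bit_flip_ord x k (m : 'I_n) : bit (flip_ord x k) m = bit x m (+) (m == k).
Proof. exact: bit_flip. Qed.

Lemma par_flip_ord x k : par n (flip_ord x k) = ~~ par n x.
Proof. exact: par_flip. Qed.

Lemma flip_ordK k : involutive (flip_ord ^~ k).
Proof. by move=> x; apply: ord_bit_inj => m; rewrite !bit_flip_ord addbK. Qed.

Lemma flip_ordC x k l : flip_ord (flip_ord x k) l = flip_ord (flip_ord x l) k.
Proof. by apply: ord_bit_inj => m; rewrite !bit_flip_ord addbAC. Qed.

Lemma flip_ord_inj x : injective (flip_ord x).
Proof.
move=> k l /(congr1 (fun y : 'I__ => bit y k)); rewrite !bit_flip_ord eqxx.
by move/addbI/esym/eqP.
Qed.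

(** Compare digits. If [a] were neither [k] nor [l], digit [a] would force [b = a], and digit [k]
    would then be contradictory. *)
Lemma common_neighbour x k l a b : k != l ->
  flip_ord x a = flip_ord (flip_ord (flip_ord x k) l) b -> a = k \/ a = l.
Proof.
move=> kl eq_ab; have [|ak] := eqVneq a k; first by left.
have [|al] := eqVneq a l; first by right.
have h (m : 'I_n) : (m == a) = (m == k) (+) (m == l) (+) (m == b).
  have /(congr1 (fun y : 'I__ => bit y m)) := eq_ab.
  by rewrite !bit_flip_ord -!addbA => /addbI.
have := h a; rewrite eqxx (negPf ak) (negPf al) /= => /esym/eqP ab.
by have := h k; rewrite -ab eqxx (negPf kl) addTb; case: eqP.
Qed.

Lemma flip2_neq x k l : k != l -> flip_ord (flip_ord x k) l != x.
Proof.
move=> kl; apply/eqP => /(congr1 (fun y : 'I__ => bit y k)).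
by rewrite !bit_flip_ord eqxx (negPf kl) addbF; case: bit.
Qed.

(** Flipping digit 0, which exists as [n >= 1], exchanges the two vertex classes. *)
Lemma card_inU : (1 <= n)%N -> #|[pred x | @inU n x]| = (2 ^ n.-1)%N.
Proof.
move=> n1; pose k0 : 'I_n := Ordinal n1.
have : #|[pred x | @inU n x]| = #|[predC [pred x | @inU n x]]|.
  rewrite -(card_image (inv_inj (flip_ordK k0))); apply: eq_card => x.
  rewrite -{1}(flip_ordK k0 x) (mem_image (inv_inj (flip_ordK k0))).
  by rewrite !inE /inU par_flip_ord.
move=> e; have := cardC [pred x | @inU n x]; rewrite -e card_ord addnn.
have e2 : (2 ^ n = (2 ^ n.-1).*2)%N by rewrite -mul2n -expnS prednK.
by move=> /esym; rewrite {1}e2 => /double_inj/esym.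
Qed.

End Cube.

(** * Dimension bound from a spanning family *)

Section Span.
Variables (R : realType) (H : lmodType R[i]).

(** The coefficient matrix has [d.+1] rows and at most [d] columns, so a nonzero row vector
    annihilates it; its entries are the required relation. *)
Lemma dim_le_span (J : finType) (A : {pred J}) (e : J -> H) (d : nat)
    (S : H -> Prop) : (#|A| <= d)%N ->
  (forall v, S v -> exists c : J -> R[i], v = \sum_(j in A) c j *: e j) ->
  dim_le d S.
Proof.
move=> leAd span vs Svs.
have [c hc] := choice (fun i => span _ (Svs i)).
pose M := \matrix_(i < d.+1, j < #|A|) c i (enum_val j).
have : kermx M != 0.
  rewrite kermx_eq0 /row_free neq_ltn; apply/orP; left.
  by rewrite ltnS (leq_trans (rank_leq_col M)).
move=> /rowV0Pn[u /sub_kermxP uM u0]; exists (fun i => u 0 i); split.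
  by apply/existsP; apply: contraNT u0 => /existsPn h; apply/eqP/rowP=> i;
    rewrite mxE; apply/eqP; move: (h i); rewrite negbK.
under eq_bigr do rewrite hc scaler_sumr big_enum_val /=.
rewrite exchange_big big1 //= => j _.
under eq_bigr do rewrite scalerA.
rewrite -scaler_suml; have /rowP/(_ j) := uM; rewrite !mxE => uM0.
rewrite (_ : \sum_i _ = 0) ?scale0r // -[RHS]uM0.
by apply: eq_bigr => i _; rewrite mxE.
Qed.

End Span.

(** * Relations between the vertex projections *)

Section Representation.
Variables (n : nat) (R : realType) (H : lmodType R[i]) (ip : H -> H -> R[i]).
Variable P : 'I_(2 ^ n) -> H -> H.
Hypothesis hilb : is_hilbert ip.
Hypothesis rep : is_rep_Qn ip P.
Implicit Types (x y : 'I_(2 ^ n)) (k l : 'I_n) (ks : seq 'I_n) (u v w z : H).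

Local Notation nrm := (nrm ip).
Local Notation rip := (rip ip).

Lemma proj_linop x : linop (P x).
Proof. by case: rep => /(_ x)[]. Qed.

Lemma proj_idem x v : P x (P x v) = P x v.
Proof. by case: rep => /(_ x)[]. Qed.

Lemma proj_sym x u v : ip (P x u) v = ip u (P x v).
Proof. by case: rep => /(_ x)[]. Qed.

Lemma proj_nrm x v : nrm (P x v) <= nrm v.
Proof.
have := rip_ge0 hilb (v - P x v).
rewrite nrm_le // !(ripDl, ripDr, ripNl, ripNr) // (ripC hilb v).
have -> : rip v (P x v) = rip (P x v) (P x v) by rewrite /rip proj_sym proj_idem.
lra.
Qed.

Lemma proj_bounded x : bounded ip (P x).
Proof. by exists 1 => // v; rewrite mul1r proj_nrm. Qed.

Lemma proj_sum (c : bool) v : \sum_(y : 'I_(2 ^ n) | par n y == c) P y v = v.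
Proof.
case: rep => _ sumU sumV _; case: c; [rewrite -[RHS]sumV|rewrite -[RHS]sumU].
  by apply: eq_bigl => y; rewrite eqb_id.
by apply: eq_bigl => y; rewrite eqbF_neg.
Qed.

(** Apply the sum over the class of [y] to [w = P y v]: the terms other than [y] sum to 0, and
    pairing with [w] makes a sum of squared norms vanish. *)
Lemma proj_orth x y v : par n x = par n y -> x != y -> P x (P y v) = 0.
Proof.
move=> parxy xy; set w := P y v.
have := proj_sum (par n y) w; rewrite (bigD1 y) //= {1}/w proj_idem -/w.
rewrite -[RHS]addr0 => /addrI sum0.
have : \sum_(z : 'I_(2 ^ n) | (par n z == par n y) && (z != y)) rip (P z w) (P z w) = 0.
  transitivity (rip (\sum_(z : 'I_(2 ^ n) | (par n z == par n y) && (z != y)) P z w) w).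
    rewrite (big_morph (rip ^~ w) (fun a b => ripDl hilb a b w) (_ : _ = 0)).
      by apply: eq_bigr => z _; rewrite /rip !proj_sym proj_idem.
    by rewrite /rip ip0l.
  by rewrite sum0 /rip ip0l.
move/psumr_eq0P => h; apply: (nrm0_eq0 hilb); apply/eqP.
by rewrite -sqrf_eq0 nrm_sqr // h ?parxy ?eqxx // => z _; rewrite rip_ge0.
Qed.

(** The defining relation covers only [U] before [V]; the other order follows by taking adjoints. *)
Lemma proj_nonadjacent x y v : par n x != par n y ->
  (forall k, y != flip_ord x k) -> P x (P y v) = 0.
Proof.
have UV x' y' v' : ~~ par n x' -> par n y' ->
    (forall k, y' != flip_ord x' k) -> P x' (P y' v') = 0.
  case: rep => _ _ _ h Ux Vy nadj; apply: h => // -[k /= e].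
  by have /eqP := nadj k; apply; apply: val_inj.
case: (boolP (par n y)) => [Vy|Uy]; first by rewrite eqb_id => *; exact: UV.
rewrite eqbF_neg negbK => Vx nadj; apply: (ip_eq0 hilb).
rewrite !proj_sym UV // ?(ipC hilb 0) ?ip0l ?conjc0 // => k.
by apply: contra_neq (nadj k) => ->; rewrite flip_ordK.
Qed.

Lemma proj_expand x v : P x v = \sum_k P x (P (flip_ord x k) v).
Proof.
have inj := @flip_ord_inj n x.
rewrite -(big_image _ _ (flip_ord x) predT (fun y => P x (P y v))).
rewrite big_uniq ?(map_inj_uniq inj) ?enum_uniq //=.
rewrite -{1}(proj_sum (~~ par n x) v) (linop_sum (proj_linop x)).
rewrite big_mkcond [RHS]big_mkcond; apply: eq_bigr => y _ /=.
case: imageP => [[k _ ->]|nadj]; first by rewrite par_flip_ord eqxx.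
case: eqP => // pary; apply: proj_nonadjacent.
  by rewrite pary; case: par.
by move=> k; apply/eqP => e; apply: nadj; exists k.
Qed.

(** The product of projections along a walk, leftmost at its start [x]. Recording directions instead
    of vertices makes every list a valid walk. *)
Fixpoint walk x ks v : H :=
  if ks is k :: ks' then P x (walk (flip_ord x k) ks' v) else P x v.

Lemma proj_walk_id x ks v : P x (walk x ks v) = walk x ks v.
Proof. by case: ks => [|k ks] /=; rewrite proj_idem. Qed.

(* Expand [P x P y = 0], where [y] is the corner of the square opposite to [x]:
   only the two other corners are adjacent to both [x] and [y]. *)
Lemma walk_swap x k l ks v : k != l ->
  walk x [:: k, l & ks] v = - walk x [:: l, k & ks] v.
Proof.
move=> kl /=; rewrite (flip_ordC x l k).
set y := flip_ord (flip_ord x k) l; rewrite -(proj_walk_id y).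
move: (walk y ks v) => w; apply/eqP; rewrite -addr_eq0; apply/eqP.
have <- : P x (P y w) = 0.
  by rewrite proj_orth ?par_flip_ord ?negbK // eq_sym flip2_neq.
rewrite [RHS]proj_expand (bigD1 k) // (bigD1 l) 1?eq_sym //= big1 ?addr0 //.
move=> a /andP[ak al]; rewrite (@proj_nonadjacent (flip_ord x a) y) ?(linop0 (proj_linop x)) //.
  by rewrite !par_flip_ord; case: par.
move=> b; apply/eqP => e.
have /(common_neighbour kl)[] : flip_ord x a = flip_ord y b.
- by rewrite e flip_ordK.
- exact/eqP.
- exact/eqP.
Qed.

Lemma walk_back_sym x k u v :
  ip (walk x [:: k; k] u) v = ip u (walk x [:: k; k] v).
Proof. by rewrite /= flip_ordK !proj_sym. Qed.

(** This is the central element [W_k]. *)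
Definition back_sum k v : H := \sum_(x | inU x) walk x [:: k; k] v.

Lemma proj_back_sum x k v : P x (back_sum k v) = walk x [:: k; k] v.
Proof.
have onU y : inU y -> P y (back_sum k v) = walk y [:: k; k] v.
  move=> Uy; rewrite /back_sum (linop_sum (proj_linop y)) (bigD1 y) //=.
  rewrite proj_idem big1 ?addr0 // => z /andP[Uz zy].
  rewrite proj_orth // 1?eq_sym //.
  by move: Uy Uz; rewrite /inU => /negPf-> /negPf->.
case: (boolP (inU x)) => [/onU //|]; rewrite /inU negbK => Vx.
rewrite proj_expand.
transitivity (\sum_l walk x [:: k; k; l] v).
  apply: eq_bigr => l _; rewrite onU; last by rewrite /inU par_flip_ord negbK.
  change (walk x [:: l; k; k] v = walk x [:: k; k; l] v).
  (* Two swaps carry [l] past both steps [k], and their signs cancel. *)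
  have [->//|lk] := eqVneq l k; rewrite [LHS]walk_swap //=.
  have /= -> := walk_swap (flip_ord x k) [::] v lk.
  by rewrite (linopN (proj_linop x)) opprK.
(* After the detour along [k] the walk is back at [x], so summing over [l] collapses by
   [proj_expand]. *)
rewrite /= flip_ordK -(linop_sum (proj_linop x)).
rewrite -(linop_sum (proj_linop (flip_ord x k))).
by rewrite -proj_expand.
Qed.

Lemma back_sum_sym k u v : ip (back_sum k u) v = ip u (back_sum k v).
Proof.
rewrite (ipC hilb (back_sum k v)) /back_sum.
rewrite !(big_morph (ip ^~ _) (fun a b => ipDl hilb a b _) (ip0l hilb _)).
by rewrite rmorph_sum; apply: eq_bigr => x _; rewrite walk_back_sym (ipC hilb (walk x _ v)).
Qed.

(** [P x], [back_sum k] and their product [walk x [:: k; k]] are all self-adjoint, so the two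
    factors commute. *)
Lemma back_sum_comm k x v : P x (back_sum k v) = back_sum k (P x v).
Proof.
apply/eqP; rewrite -subr_eq0; apply/eqP; apply: (ip_eq0 hilb).
set d := (d in ip _ d); rewrite {1}/d ipDl // -scaleN1r ipZl //.
rewrite proj_back_sum walk_back_sym back_sum_sym proj_sym proj_back_sum.
by rewrite mulN1r subrr.
Qed.

Lemma walk_linop x ks : linop (walk x ks).
Proof.
by elim: ks x => [|k ks IH] x a u v /=; rewrite ?IH proj_linop.
Qed.

Lemma walk_nrm x ks v : nrm (walk x ks v) <= nrm v.
Proof.
elim: ks x => [|k ks IH] x /=; first exact: proj_nrm.
exact: le_trans (proj_nrm _ _) (IH _).
Qed.

Lemma back_sum_linop k : linop (back_sum k).
Proof.
move=> a u v; rewrite /back_sum scaler_sumr -big_split.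
by apply: eq_bigr => x _; exact: walk_linop.
Qed.

Lemma back_sum_bounded k : bounded ip (back_sum k).
Proof.
exists (\sum_(x | @inU n x) 1) => [|v]; first by rewrite sumr_ge0.
rewrite mulr_suml /back_sum.
elim/big_ind2: _ => [|a b c d ab cd|x _]; first by rewrite nrm0.
  by apply: le_trans (nrmD hilb _ _) _; rewrite lerD.
by rewrite mul1r walk_nrm.
Qed.

(** Arbitrary monomials in the generators, with no adjacency between consecutive vertices. *)
Fixpoint word (xs : seq 'I_(2 ^ n)) v : H :=
  if xs is x :: xs' then P x (word xs' v) else v.

(** Left multiplication by a generator is absorbed, kills the walk, or prolongs it by one step; the
    endpoint is tracked so that closed walks can be recognised. *)
Lemma proj_walk y x ks :
  (forall v, P y (walk x ks v) = 0) \/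
  exists2 ks', foldl (@flip_ord n) y ks' = foldl (@flip_ord n) x ks &
    forall v, P y (walk x ks v) = walk y ks' v.
Proof.
have [->|yx] := eqVneq y x.
  by right; exists ks => // v; rewrite proj_walk_id.
have [pyx|pyx] := eqVneq (par n y) (par n x).
  by left=> v; rewrite -proj_walk_id proj_orth.
have [/existsP[k /eqP xE]|/existsPn nadj] := boolP [exists k, x == flip_ord y k].
  by right; exists (k :: ks) => [|v] /=; rewrite -xE.
by left=> v; rewrite -proj_walk_id proj_nonadjacent.
Qed.

Lemma proj_word_walk x xs y :
  (forall v, P y (word xs (P x v)) = 0) \/
  exists2 ks, foldl (@flip_ord n) y ks = x &
    forall v, P y (word xs (P x v)) = walk y ks v.
Proof.
elim: xs y => [|x' xs IH] y /=; first exact: (proj_walk y x [::]).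
have [h|[ks <- h]] := IH x'.
  by left=> v; rewrite h (linop0 (proj_linop y)).
have [h'|[ks' e h']] := proj_walk y x' ks.
  by left=> v; rewrite h h'.
by right; exists ks' => // v; rewrite h h'.
Qed.

(** * Scalar corners and rank in an irreducible representation *)

Section Irreducible.
Hypothesis irr : irreducible_rep ip P.

Lemma walk_back_scalar k :
  exists c : R[i], forall x v, walk x [:: k; k] v = c *: P x v.
Proof.
case: irr => nz irrS.
have [c hc] : exists c : R[i], forall v, back_sum k v = c *: v.
  apply: (schur hilb proj_linop proj_bounded nz irrS).
  - exact: back_sum_linop.
  - exact: back_sum_bounded.
  - by move=> u v; rewrite /rip back_sum_sym.
  - exact: back_sum_comm.
by exists c => x v; rewrite -proj_back_sum hc (linopZ (proj_linop x)).
Qed.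

(** Swaps push the first [k] through [a], one sign per step, until it meets the second [k] and forms
    a scalar loop. *)
Lemma walk_cancel x k a b : k \notin a ->
  exists c : R[i], forall v, walk x (k :: a ++ k :: b) v = c *: walk x (a ++ b) v.
Proof.
elim: a x => [|l a IH] x.
  have [c hc] := walk_back_scalar k; exists c => v.
  rewrite -[in RHS]proj_walk_id -hc /= flip_ordK.
  by rewrite proj_walk_id.
rewrite inE negb_or => /andP[kl /(IH (flip_ord x l))[c hc]].
exists (- c) => v; rewrite cat_cons walk_swap //.
by rewrite -[walk x _ v]/(P x (walk _ (k :: _) v)) hc (linopZ (proj_linop x)) scaleNr.
Qed.

Lemma mem_split_first (T : eqType) (a : T) (s : seq T) : a \in s ->
  exists s1 s2, s = s1 ++ a :: s2 /\ a \notin s1.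
Proof.
elim: s => // b s IH; rewrite inE; have [->|ab] := eqVneq a b.
  by exists [::], s.
move=> /IH[s1 [s2 [-> h]]]; exists (b :: s1), s2.
by rewrite inE negb_or ab.
Qed.

Lemma bit_endpoint x ks k :
  bit (foldl (@flip_ord n) x ks) k = bit x k (+) odd (count_mem k ks).
Proof.
elim: ks x => [|l ks IH] x /=; first by rewrite addbF.
by rewrite IH bit_flip_ord oddD oddb addbA [k == l]eq_sym.
Qed.

(** Induction on length, removing two equal directions at a time. *)
Lemma walk_closed_scalar x ks : foldl (@flip_ord n) x ks = x ->
  exists c : R[i], forall v, walk x ks v = c *: P x v.
Proof.
have [m] := ubnP (size ks); elim: m ks => // m IH [|k ks] /= ltm e.
  by exists 1 => v; rewrite scale1r.
(* In a closed walk each direction occurs an even number of times, so the first one recurs. *)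
have kks : k \in ks.
  apply: contraT => /count_memPn k0.
  have := bit_endpoint x (k :: ks) k; rewrite /= e k0 eqxx addn0 /=.
  by case: bit.
have [a [b [ksE ka]]] := mem_split_first kks.
(* Dropping both occurrences of [k] preserves all parities, so the shorter walk is still closed. *)
have eab : foldl (@flip_ord n) x (a ++ b) = x.
  apply: ord_bit_inj => j; rewrite -{2}e -[foldl _ _ ks]/(foldl _ x (k :: ks)).
  rewrite !bit_endpoint ksE /= !count_cat /= !oddD !oddb.
  by case: (k == j); case: odd; case: odd; case: bit.
have [|c hc] := IH (a ++ b) _ eab.
  by move: ltm; rewrite ksE !size_cat /= addnS !ltnS => /ltnW.
have [d hd] := walk_cancel x b ka.
by exists (d * c) => v; rewrite -scalerA -hc -hd -ksE.
Qed.

Lemma corner_scalar x xs :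
  exists c : R[i], forall v, P x (word xs (P x v)) = c *: P x v.
Proof.
have [h|[ks /walk_closed_scalar[c hc] h]] := proj_word_walk x xs x.
  by exists 0 => v; rewrite h scale0r.
by exists c => v; rewrite h hc.
Qed.

(* The vectors orthogonal to the cyclic subspace generated by [P x v] form a
   closed invariant subspace; as corners are scalar it contains [P x u]. *)
Lemma proj_orth_eq0 x u v : ip (P x u) (P x v) = 0 -> P x u != 0 -> P x v = 0.
Proof.
move=> uv0 u0; case: irr => _ irrS.
pose A w := exists xs, w = word xs (P x v).
have [|a||h] := irrS (fun z => forall w, A w -> ip z w = 0) _ (@orth_closed _ _ _ hilb A).
- split=> [w _|a z z' hz hz' w Aw]; first by rewrite ip0l.
  by rewrite ipDl // ipZl // hz // hz' // mulr0 addr0.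
- by move=> z hz w [xs ->]; rewrite proj_sym; apply: hz; exists (a :: xs).
- by move=> h; apply: (ip_eq0 hilb); apply: h; exists [::].
case/eqP: u0; apply: h => _ [xs ->]; have [c hc] := corner_scalar x xs.
by rewrite -proj_idem proj_sym hc ipZr // uv0 mulr0.
Qed.

(** Take [e = P x u] nonzero if possible. Subtracting from [P x v] its orthogonal projection on [e]
    leaves a vector of the range of [P x] orthogonal to [e], which vanishes by [proj_orth_eq0]. *)
Lemma proj_rank1 x : exists e, forall v, exists c : R[i], P x v = c *: e.
Proof.
have [[u /eqP u0]|h] := pselect (exists u, P x u <> 0); last first.
  exists 0 => v; exists 0; rewrite scaler0; apply: contrapT => ?; apply: h.
  by exists v.
have n0 : ip (P x u) (P x u) != 0.
  by apply: contra u0 => /eqP/(ip_eq0 hilb) ->.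
exists (P x u) => v; exists (ip (P x v) (P x u) / ip (P x u) (P x u)).
set c := _ / _; apply/eqP; rewrite -subr_eq0 -(linopZ (proj_linop x)).
rewrite -(linopB (proj_linop x)); apply/eqP; apply: proj_orth_eq0 u0.
rewrite ipC // (linopB (proj_linop x)) (linopZ (proj_linop x)).
by rewrite ipDl // -scaleNr ipZl // mulNr divfK // subrr conjc0.
Qed.

End Irreducible.
End Representation.

Theorem theorem3p5 (n : nat) (hn : (1 <= n)%N)
  (R : realType) (H : lmodType R[i]) (ip : H -> H -> R[i])
  (P : 'I_(2 ^ n) -> H -> H) :
  is_hilbert ip -> is_rep_Qn ip P -> irreducible_rep ip P ->
  @dim_le R H (2 ^ n.-1) (fun _ => True) /\
  (forall (x : 'I_(2 ^ n)), @dim_le R H 1 (fun v => exists w, v = P x w)).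
Proof.
move=> hilb rep irr; have [e he] := choice (proj_rank1 hilb rep irr); split.
  (* Since the [P u] with [u] in [U] sum to the identity, the corresponding vectors [e u] span
     [H]. *)
  apply: (dim_le_span (A := [pred x | @inU n x]) (e := e)) => [|v _].
    by rewrite card_inU.
  have [c hc] := choice (fun x => he x v); exists c; case: rep => _ sumU _ _.
  by rewrite -[LHS]sumU; apply: eq_bigr => x _; rewrite hc.
move=> x; apply: (dim_le_span (A := pred1 x) (e := e)) => [|_ [w ->]].
  by rewrite card1.
by have [c hc] := he x w; exists (fun=> c); rewrite big_pred1_eq.
Qed.
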